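(* Let $f\in\mathbb{R}[a,b,c,d]$ be a symmetric form of degree $4$ with $f(1,1,1,1)=0$. (1) If $f(-1,-1,1,1)\ge0$ and $f(t,1,1,1)\ge0$ for all $t\in\mathbb{R}$, then $f(a,b,c,d)\ge0$ for all $a,b,c,d\in\mathbb{R}$. (2) If $f(t,1,1,1)\ge0$ and $f(0,0,t,1)\ge0$ for all $t\ge0$, then $f(a,b,c,d)\ge0$ for all $a,b,c,d\in\mathbb{R}_+$, where $\mathbb{R}_+=\{x\in\mathbb{R}: x\ge0\}$. *)

(* Defs.v *)
From mathcomp Require Export all_boot all_order all_algebra.
From mathcomp Require Export reals.
From mathcomp.multinomials Require Export mpoly.
Import GRing.Theory.
Local Open Scope ring_scope.

Definition eval4 (R : comNzRingType) (f : {mpoly R[4]}) (a b c d : R) : R :=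
  f.@[tnth [tuple a; b; c; d]].

(* Main.v *)
Require Import Defs.
From mathcomp Require Import zify ring lra.

(**
A symmetric quartic form is a combination of the five weight-four monomials
[e1^4, e1^2 e2, e1 e3, e2^2, e4] in the elementary symmetric polynomials.  The
condition [f(1,1,1,1) = 0] removes one parameter, and the remaining four are
visible on the two curves of the hypotheses: for suitable [A], [B], [C], [E],
  [f(t,1,1,1) = (t - 1)^2 (A t^2 + B t + C)],
  [3 f(0,0,t,1) = (t - 1)^2 (3 A (t - 1)^2 + (10 A + B) t) + 3 E t^2].
The forms [formA], [formB], [formC], [formE] below are dual to these
coordinates: [3 f = A formA + B formB + C formC + 3 E formE].

On the positive orthant all four dual forms are nonnegative, which settles
[B >= 0].  If [B < 0], put [w = - B / (2 A)], the point where the quadratic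
factor on the first curve is smallest.  The hypothesis on the first curve says
[C >= A w^2], and the one on the second curve, a quadratic inequality in
[(t - 1)^2 / t], says [E >= A (w - 5)^2 / 9] as soon as [w > 5].  By
monotonicity in [C] and [E] only the extremal forms remain,
  [formA - 2 w formB + w^2 formC]                          for [0 <= w <= 5],
  [formA - 2 w formB + w^2 formC + (w - 5)^2 / 3 * formE]  for [w >= 5],
which vanish at [(w,1,1,1)].  Once the variables are sorted and expressed
through their successive gaps, three times such a form is one explicit square
plus terms with nonnegative coefficients; the shape of the square depends on
whether [w <= 1] (the three equal variables are the largest),
[1 <= w <= 5] or [w >= 5].

On the whole of [R^4] the natural coordinates are [s = a + b + c + d] and
[p = a + b - c - d], [q = a + c - b - d], [r = a + d - b - c].  The form is
then a quadratic polynomial in [s] with coefficients depending on [p], [q],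
[r], and its discriminant is controlled by the two inequalities
[(p^2 + q^2 + r^2)^2 >= 3 (p^2 q^2 + q^2 r^2 + r^2 p^2)] and
[(p^2 + q^2 + r^2) (p^2 q^2 + q^2 r^2 + r^2 p^2) >= 9 p^2 q^2 r^2].
*)

Set Implicit Arguments.
Unset Strict Implicit.
Unset Printing Implicit Defensive.

Import Order.TTheory GRing.Theory Num.Theory.
Local Open Scope ring_scope.

(** * Symmetric quartics in elementary symmetric polynomials *)

Definition e1 (R : comNzRingType) (a b c d : R) := a + b + c + d.
Definition e2 (R : comNzRingType) (a b c d : R) :=
  a * b + a * c + a * d + b * c + b * d + c * d.
Definition e3 (R : comNzRingType) (a b c d : R) :=
  a * b * c + a * b * d + a * c * d + b * c * d.
Definition e4 (R : comNzRingType) (a b c d : R) := a * b * c * d.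

Lemma meval_mwiden (n : nat) (R : comNzRingType) (p : {mpoly R[n]})
    (v : 'I_n.+1 -> R) :
  (mwiden p).@[v] = p.@[fun i => v (widen_ord (leqnSn n) i)].
Proof.
rewrite [RHS]mevalE {1}(mpolyE p).
rewrite (big_morph (@mwiden n R) (@mwidenD n R) (@mwiden0 n R)).
rewrite (big_morph _ (mevalD v) (meval0 v)); apply: eq_bigr => m _.
rewrite mwidenZ mwidenX mevalZ mevalX big_ord_recr /= mnmwiden_ordmax mulr1.
by congr (_ * _); apply: eq_bigr => i _; rewrite mnmwiden_widen.
Qed.

(** Elementary symmetric polynomials are sums over subsets, which do not
    compute; this recursion on the number of variables does. *)
Lemma meval_mesymS (n k : nat) (R : comNzRingType) (v : 'I_n.+1 -> R) :
  (mesym n.+1 R k.+1).@[v]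
  = (mesym n R k.+1).@[fun i => v (widen_ord (leqnSn n) i)]
    + (mesym n R k).@[fun i => v (widen_ord (leqnSn n) i)] * v ord_max.
Proof. by rewrite mesymSS mevalD mevalM !meval_mwiden mevalXU. Qed.

Lemma meval_mesym4 (R : comNzRingType) (a b c d : R) (k : nat) :
  (mesym 4 R k.+1).@[tnth [tuple a; b; c; d]]
  = nth 0 [:: e1 a b c d; e2 a b c d; e3 a b c d; e4 a b c d] k.
Proof.
case: k => [|[|[|[|k]]]]; last by rewrite mesym_geqnE // meval0 /= nth_nil.
all: rewrite !(meval_mesymS, mesym0E, meval1, (@mesym_geqnE 0 R), meval0) //=.
all: rewrite !(tnth_nth 0) /= /e1 /e2 /e3 /e4; ring.
Qed.

Definition weight4_monomials : seq 'X_{1..4} :=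
  [seq [multinom t] | t <- [:: [tuple 4; 0; 0; 0]; [tuple 2; 1; 0; 0];
     [tuple 1; 0; 1; 0]; [tuple 0; 2; 0; 0]; [tuple 0; 0; 0; 1]]]%N.

Lemma mem_weight4_monomials (m : 'X_{1..4}) :
  mnmwgt m = 4%N -> m \in weight4_monomials.
Proof.
case: m => [[[|m0 [|m1 [|m2 [|m3 [|? ?]]]]] // sm]].
rewrite /mnmwgt !big_ord_recr big_ord0 /= !multinomE !(tnth_nth 0%N) /= => w.
have {w}: [|| [:: m0; m1; m2; m3] == [:: 4; 0; 0; 0],
    [:: m0; m1; m2; m3] == [:: 2; 1; 0; 0],
    [:: m0; m1; m2; m3] == [:: 1; 0; 1; 0],
    [:: m0; m1; m2; m3] == [:: 0; 2; 0; 0] |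
    [:: m0; m1; m2; m3] == [:: 0; 0; 0; 1]]%N.
  by rewrite !eqseq_cons !eqxx !andbT; lia.
by rewrite /weight4_monomials !inE.
Qed.

(** The fundamental theorem writes [f] as [t(e1, e2, e3, e4)] where every
    monomial of [t] has weight four, and only five monomials do. *)
Lemma symmetric_quartic4E (R : comNzRingType) (f : {mpoly R[4]}) :
    f \is symmetric -> f \is 4.-homog ->
  exists k1 k2 k3 k4 k5 : R, forall a b c d : R,
  eval4 R f a b c d =
    k1 * e1 a b c d ^+ 4 + k2 * (e1 a b c d ^+ 2 * e2 a b c d)
    + k3 * (e1 a b c d * e3 a b c d) + k4 * e2 a b c d ^+ 2 + k5 * e4 a b c d.
Proof.
move=> /sym_fundamental_homog /[apply] -[t [<- /dhomogP t_wgt]].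
have: t = \sum_(m <- weight4_monomials) t@_m *: 'X_[m].
  rewrite {1}(mpolyE t) [RHS](bigID (fun m => m \in msupp t)) /=.
  rewrite [X in _ = _ + X]big1 => [|m /memN_msupp_eq0 ->]; last exact: scale0r.
  rewrite addr0 -[RHS]big_filter; apply: perm_big.
  apply: uniq_perm => // [|m]; first exact: filter_uniq.
  rewrite mem_filter; case: (boolP (m \in msupp t)) => // mt.
  by rewrite (mem_weight4_monomials (t_wgt m mt)).
rewrite /weight4_monomials /= !big_cons big_nil.
move: (mcoeff _ _) (mcoeff _ _) (mcoeff _ _) (mcoeff _ _) (mcoeff _ _).
move=> k5 k4 k3 k2 k1 tE; exists k1, k2, k3, k4, k5 => a b c d.
rewrite /eval4 comp_mpoly_meval tE.
rewrite !(mevalD, mevalZ, mevalX, meval0) !big_ord_recr !big_ord0 /=.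
rewrite !multinomE !(tnth_nth 0%N) /= !tnth_mktuple !meval_mesym4 /=.
by ring.
Qed.

(** * Coordinates adapted to the two test curves *)

Definition formA (R : comNzRingType) (a b c d : R) :=
  3 * e1 a b c d ^+ 4 - 14 * (e1 a b c d ^+ 2 * e2 a b c d)
  + 8 * e2 a b c d ^+ 2 + 21 * (e1 a b c d * e3 a b c d) - 48 * e4 a b c d.
Definition formB (R : comNzRingType) (a b c d : R) :=
  e1 a b c d ^+ 2 * e2 a b c d + 3 * (e1 a b c d * e3 a b c d)
  - 4 * e2 a b c d ^+ 2.
Definition formC (R : comNzRingType) (a b c d : R) :=
  e1 a b c d * e3 a b c d - 16 * e4 a b c d.
(** Up to normalization, the invariant of degree two of the binary quartic
    with roots [a], [b], [c], [d]. *)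
Definition formE (R : comNzRingType) (a b c d : R) :=
  e2 a b c d ^+ 2 - 3 * (e1 a b c d * e3 a b c d) + 12 * e4 a b c d.

Lemma symmetric_quartic4_vanishing (R : comNzRingType) (f : {mpoly R[4]}) :
    f \is symmetric -> f \is 4.-homog -> eval4 R f 1 1 1 1 = 0 ->
  exists A B C E : R, forall a b c d : R,
  3 * eval4 R f a b c d
  = A * formA a b c d + B * formB a b c d + C * formC a b c d
    + 3 * E * formE a b c d.
Proof.
move=> fS fH; have [k1 [k2 [k3 [k4 [k5 fE]]]]] := symmetric_quartic4E fS fH.
rewrite fE /e1 /e2 /e3 /e4 => f1.
have {f1} k5E : k5 = - (256 * k1 + 96 * k2 + 16 * k3 + 36 * k4).
  by apply/eqP; rewrite -addr_eq0 -f1; apply/eqP; ring.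
exists k1, (14 * k1 + 3 * k2), (81 * k1 + 27 * k2 + 3 * k3 + 9 * k4).
exists (16 * k1 + 4 * k2 + k4) => a b c d.
by rewrite fE k5E /formA /formB /formC /formE; ring.
Qed.

Lemma combination_t111 (R : comNzRingType) (A B C E t : R) :
  A * formA t 1 1 1 + B * formB t 1 1 1 + C * formC t 1 1 1
    + 3 * E * formE t 1 1 1
  = 3 * ((t - 1) ^+ 2 * (A * t ^+ 2 + B * t + C)).
Proof. by rewrite /formA /formB /formC /formE /e1 /e2 /e3 /e4; ring. Qed.

Lemma combination_00t1 (R : comNzRingType) (A B C E t : R) :
  A * formA 0 0 t 1 + B * formB 0 0 t 1 + C * formC 0 0 t 1
    + 3 * E * formE 0 0 t 1
  = (t - 1) ^+ 2 * (3 * A * (t - 1) ^+ 2 + (10 * A + B) * t) + 3 * E * t ^+ 2.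
Proof. by rewrite /formA /formB /formC /formE /e1 /e2 /e3 /e4; ring. Qed.

(** Nonnegativity of expressions built from assumed nonnegative quantities by
    sums, products and powers; a difference is accepted when the inequality
    between its terms is assumed. *)
Ltac nonneg_terms :=
  repeat first [ assumption | apply: sqr_ge0 | apply: ler0n | apply: ler01
               | apply: exprn_ge0 | apply: mulr_ge0
               | rewrite subr_ge0; assumption | apply: addr_ge0 ].

(** * Quadratic polynomials on a half-line *)

(** A quadratic polynomial that is nonnegative near [1] except possibly at [1]
    is nonnegative at [1]: otherwise its values at [1 + h] and [1 - h], whose
    mean is its value at [1] plus [A h^2], could not both be nonnegative for
    small [h]. *)
Lemma quadratic_ge0_at1 (R : realFieldType) (A B C : R) :
  (forall t, 0 <= t -> 0 <= (t - 1) ^+ 2 * (A * t ^+ 2 + B * t + C)) ->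
  0 <= A + B + C.
Proof.
move=> q_ge0; rewrite leNgt; apply/negP => q1_lt0.
have C_ge0 : 0 <= C by have := q_ge0 0 (lexx 0); lra.
have off1 (t : R) : 0 <= t -> t - 1 != 0 -> 0 <= A * t ^+ 2 + B * t + C.
  move=> /q_ge0 + t1; rewrite pmulr_rge0 // exprn_even_gt0 //=.
have [e [e_gt0 eE]] : exists e, 0 < e /\ A + B + C = - e.
  by exists (- (A + B + C)); split; lra.
have [h [h_gt0 h_le1 Ah_lt]] : exists h, [/\ 0 < h, h <= 1 & A * h < e].
  have [A_lt1|A_ge1] := ltP A e; first by exists 1; split; lra.
  exists (e / (2 * A)); split; [apply: divr_gt0; lra| |].
    by rewrite ler_pdivrMr; lra.
  by have -> : A * (e / (2 * A)) = e / 2; [field; rewrite gt_eqF|]; lra.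
have qm : 0 <= A * (1 - h) ^+ 2 + B * (1 - h) + C.
  by apply: off1; [lra|rewrite addrAC subrr add0r oppr_eq0 gt_eqF].
have qp : 0 <= A * (1 + h) ^+ 2 + B * (1 + h) + C.
  by apply: off1; [lra|rewrite addrAC subrr add0r gt_eqF].
have : A * h * h < e * h by rewrite ltr_pM2r.
have : e * h <= e by rewrite ger_pMr.
by nra.
Qed.

(** For [b < 0] the minimum of the quadratic is attained on the half-line. *)
Lemma quadratic_halfline (R : realFieldType) (a b c : R) :
  0 <= a -> (forall t, 0 <= t -> 0 <= a * t ^+ 2 + b * t + c) ->
  b < 0 -> 0 < a /\ b ^+ 2 <= 4 * a * c.
Proof.
move=> a_ge0 q_ge0 b_lt0.
have a_gt0 : 0 < a.
  rewrite lt_def a_ge0 andbT; apply/eqP => a0.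
  have c_ge0 : 0 <= c by have := q_ge0 0 (lexx 0); lra.
  have := q_ge0 ((c + 1) / - b); rewrite a0 mul0r add0r.
  have -> : b * ((c + 1) / - b) = - (c + 1) by field; rewrite lt_eqF.
  by have := @divr_ge0 _ (c + 1) (- b); lra.
split=> //; have := q_ge0 (- b / (2 * a)).
have -> : a * (- b / (2 * a)) ^+ 2 + b * (- b / (2 * a)) + c
          = (4 * a * c - b ^+ 2) / (4 * a).
  by field; rewrite gt_eqF.
have := @divr_ge0 _ (- b) (2 * a).
by rewrite [_ <= _ / (4 * a)]pmulr_lge0 ?invr_gt0; lra.
Qed.

Lemma quadratic_line_lead (R : realFieldType) (a b c : R) :
  (forall t, 0 <= a * t ^+ 2 + b * t + c) -> 0 <= a.
Proof.
move=> q_ge0; rewrite leNgt; apply/negP => a_lt0.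
have c_ge0 : 0 <= c by have := q_ge0 0; rewrite expr0n /= !mulr0 !add0r.
(* the linear terms cancel between the values at opposite points *)
have even t : 0 <= a * t ^+ 2 + c by have := q_ge0 t; have := q_ge0 (- t); nra.
have := even (1 + c / - a).
have -> : a * (1 + c / - a) ^+ 2 + c = a - c + c ^+ 2 / a.
  by field; rewrite lt_eqF.
have : 0 <= c ^+ 2 / - a by rewrite divr_ge0 ?sqr_ge0 // oppr_ge0 ltW.
by rewrite invrN mulrN; lra.
Qed.

Lemma quadratic_line (R : realFieldType) (a b c : R) :
  (forall t, 0 <= a * t ^+ 2 + b * t + c) -> b ^+ 2 <= 4 * a * c.
Proof.
move=> q_ge0; have a_ge0 := quadratic_line_lead q_ge0.
case: (ltrgtP b 0) => [b_lt0|b_gt0|->].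
- by case: (quadratic_halfline a_ge0 (fun t _ => q_ge0 t) b_lt0).
- have q_opp_ge0 t : 0 <= t -> 0 <= a * t ^+ 2 + - b * t + c.
    by move=> _; rewrite -[t]opprK sqrrN mulrNN.
  by case: (quadratic_halfline a_ge0 q_opp_ge0); rewrite ?oppr_lt0 ?sqrrN.
- have c_ge0 : 0 <= c by have := q_ge0 0; rewrite expr0n /= !mulr0 !add0r.
  by rewrite expr0n /= !mulr_ge0.
Qed.

(** * The inequality on the whole space *)

Lemma am_gm_resolvent (R : realFieldType) (p q r : R) :
  9 * (p * q * r) ^+ 2 <= (p ^+ 2 + q ^+ 2 + r ^+ 2)
    * (p ^+ 2 * q ^+ 2 + q ^+ 2 * r ^+ 2 + r ^+ 2 * p ^+ 2).
Proof.
rewrite -subr_ge0.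
have -> : (p ^+ 2 + q ^+ 2 + r ^+ 2)
    * (p ^+ 2 * q ^+ 2 + q ^+ 2 * r ^+ 2 + r ^+ 2 * p ^+ 2)
    - 9 * (p * q * r) ^+ 2
  = (p * (q ^+ 2 - r ^+ 2)) ^+ 2 + (q * (r ^+ 2 - p ^+ 2)) ^+ 2
    + (r * (p ^+ 2 - q ^+ 2)) ^+ 2 by ring.
by rewrite !addr_ge0 ?sqr_ge0.
Qed.

Lemma sum_sqr_resolvent (R : realFieldType) (p q r : R) :
  3 * (p ^+ 2 * q ^+ 2 + q ^+ 2 * r ^+ 2 + r ^+ 2 * p ^+ 2)
  <= (p ^+ 2 + q ^+ 2 + r ^+ 2) ^+ 2.
Proof.
have := sqr_ge0 (p ^+ 2 - q ^+ 2); have := sqr_ge0 (q ^+ 2 - r ^+ 2).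
have := sqr_ge0 (r ^+ 2 - p ^+ 2); nra.
Qed.

(** Multiplying by [al L], where [L = p^2 + q^2 + r^2], completes the square
    in [s]; what is left is a combination of the two preceding inequalities,
    with weights [mu] and [ga], and of the hypothesis on [be]. *)
Lemma resolvent_quartic_ge0 (R : realFieldType) (al be ga mu s p q r : R) :
    0 <= al -> 0 <= ga -> 0 <= mu -> be ^+ 2 <= al * ga ->
  0 <= 3 * al * s ^+ 2 * (p ^+ 2 + q ^+ 2 + r ^+ 2)
       + 18 * be * s * (p * q * r) + mu * (p ^+ 2 + q ^+ 2 + r ^+ 2) ^+ 2
       + 3 * (ga - mu)
           * (p ^+ 2 * q ^+ 2 + q ^+ 2 * r ^+ 2 + r ^+ 2 * p ^+ 2).
Proof.
move=> al_ge0 ga_ge0 mu_ge0 disc.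
have := am_gm_resolvent p q r; have := sum_sqr_resolvent p q r.
set M := (p ^+ 2 * q ^+ 2 + _ + _); set L := p ^+ 2 + q ^+ 2 + r ^+ 2.
set U := p * q * r => LM LMU.
have L_ge0 : 0 <= L by rewrite /L; nonneg_terms.
have M_ge0 : 0 <= M by rewrite /M; nonneg_terms.
have [al0|al_neq0] := eqVneq al 0.
  have be0 : be = 0.
    apply/eqP; rewrite -sqrf_eq0 eq_le sqr_ge0 andbT.
    by rewrite (le_trans disc) // al0 mul0r.
  have -> : 3 * al * s ^+ 2 * L + 18 * be * s * U + mu * L ^+ 2
            + 3 * (ga - mu) * M = mu * (L ^+ 2 - 3 * M) + 3 * ga * M.
    by rewrite al0 be0; ring.
  by nonneg_terms.
have al_gt0 : 0 < al by rewrite lt_def al_neq0.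
have [L0|L_neq0] := eqVneq L 0.
  have [p0 q0 r0] : [/\ p = 0, q = 0 & r = 0].
    have := sqr_ge0 p; have := sqr_ge0 q; have := sqr_ge0 r.
    move: L0; rewrite /L.
    by split; apply/eqP; rewrite -sqrf_eq0; apply/eqP; lra.
  by rewrite L0 /U /M p0 q0 r0 !(expr0n, mul0r, mulr0, addr0).
have L_gt0 : 0 < L by rewrite lt_def L_neq0.
rewrite -(pmulr_rge0 _ (mulr_gt0 al_gt0 L_gt0)).
have -> : al * L * (3 * al * s ^+ 2 * L + 18 * be * s * U + mu * L ^+ 2
                    + 3 * (ga - mu) * M)
  = 3 * (al * s * L + 3 * be * U) ^+ 2
    + al * (mu * L * (L ^+ 2 - 3 * M) + 3 * ga * (L * M - 9 * U ^+ 2))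
    + 27 * (al * ga - be ^+ 2) * U ^+ 2 by ring.
by nonneg_terms.
Qed.

(** In the coordinates [s], [p], [q], [r] the combination becomes the quartic
    above with [al], [be], [ga] the coefficients of
    [16 (A t^2 + B t + C) = al (t+3)^2 + 2 be (t+3) (t-1) + ga (t-1)^2];
    the second hypothesis is nonnegativity at [(-1,-1,1,1)]. *)
Lemma combination_ge0 (R : realFieldType) (A B C E a b c d : R) :
    (forall t, 0 <= A * t ^+ 2 + B * t + C) -> 0 <= 3 * E - (A + B + C) ->
  0 <= A * formA a b c d + B * formB a b c d + C * formC a b c d
       + 3 * E * formE a b c d.
Proof.
move=> q_ge0 mu_ge0; have disc := quadratic_line q_ge0.
have := @resolvent_quartic_ge0 R (A + B + C) (3 * A + B - C)
  (9 * A - 3 * B + C) (3 * (3 * E - (A + B + C))) (a + b + c + d)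
  (a + b - c - d) (a + c - b - d) (a + d - b - c).
have al_ge0 : 0 <= A + B + C by have := q_ge0 1; lra.
have ga_ge0 : 0 <= 9 * A - 3 * B + C by have := q_ge0 (- 3); lra.
have disc' : (3 * A + B - C) ^+ 2 <= (A + B + C) * (9 * A - 3 * B + C) by nra.
move=> /(_ al_ge0 ga_ge0 (mulr_ge0 (ler0n _ _) mu_ge0) disc').
set Q := (X in 0 <= X -> _).
have -> : Q = 48 * (A * formA a b c d + B * formB a b c d + C * formC a b c d
                    + 3 * E * formE a b c d).
  by rewrite /Q /formA /formB /formC /formE /e1 /e2 /e3 /e4; ring.
by rewrite pmulr_rge0.
Qed.

(** * The inequality on the positive orthant *)

(** Reduction to sorted variables by insertion sort, each step being a
    transposition of neighbours. *)
Lemma sorted4_ind (R : realDomainType) (P : R -> R -> R -> R -> Prop) :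
    (forall a b c d, P b a c d -> P a b c d) ->
    (forall a b c d, P a c b d -> P a b c d) ->
    (forall a b c d, P a b d c -> P a b c d) ->
    (forall d x y z, 0 <= d -> 0 <= x -> 0 <= y -> 0 <= z ->
       P d (d + x) (d + x + y) (d + x + y + z)) ->
  forall a b c d, 0 <= a -> 0 <= b -> 0 <= c -> 0 <= d -> P a b c d.
Proof.
move=> swap1 swap2 swap3 gaps a b c d.
have sorted4 u1 u2 u3 u4 : 0 <= u1 -> u1 <= u2 -> u2 <= u3 -> u3 <= u4 ->
    P u1 u2 u3 u4.
  move=> u1_ge0 le12 le23 le34.
  have := gaps u1 (u2 - u1) (u3 - u2) (u4 - u3).
  rewrite !(addrC _ (_ - _)) !subrK.
  by apply; rewrite ?subr_ge0.
have sorted3 u1 u2 u3 u4 : 0 <= u4 -> 0 <= u1 -> u1 <= u2 -> u2 <= u3 ->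
    P u1 u2 u3 u4.
  move=> u4_ge0 u1_ge0 le12 le23; have [le34|/ltW le43] := leP u3 u4.
    exact: sorted4.
  apply: swap3; have [le24|/ltW le42] := leP u2 u4; first exact: sorted4.
  apply: swap2; have [le14|/ltW le41] := leP u1 u4; first exact: sorted4.
  by apply: swap1; apply: sorted4.
have sorted2 u1 u2 u3 u4 : 0 <= u4 -> 0 <= u3 -> 0 <= u1 -> u1 <= u2 ->
    P u1 u2 u3 u4.
  move=> u4_ge0 u3_ge0 u1_ge0 le12; have [le23|/ltW le32] := leP u2 u3.
    exact: sorted3.
  apply: swap2; have [le13|/ltW le31] := leP u1 u3; first exact: sorted3.
  by apply: swap1; apply: sorted3.
move=> a_ge0 b_ge0 c_ge0 d_ge0; have [leab|/ltW leba] := leP a b.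
  exact: sorted2.
by apply: swap1; apply: sorted2.
Qed.

Lemma combination_sorted_ge0 (R : realDomainType) (A B C E : R) :
    (forall d x y z, 0 <= d -> 0 <= x -> 0 <= y -> 0 <= z ->
       0 <= A * formA d (d + x) (d + x + y) (d + x + y + z)
            + B * formB d (d + x) (d + x + y) (d + x + y + z)
            + C * formC d (d + x) (d + x + y) (d + x + y + z)
            + E * formE d (d + x) (d + x + y) (d + x + y + z)) ->
  forall a b c d, 0 <= a -> 0 <= b -> 0 <= c -> 0 <= d ->
    0 <= A * formA a b c d + B * formB a b c d + C * formC a b c d
         + E * formE a b c d.
Proof.
move=> sorted_ge0; apply: sorted4_ind => // a b c d; congr (0 <= _).
all: by rewrite /formA /formB /formC /formE /e1 /e2 /e3 /e4; ring.
Qed.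

Lemma formE_ge0 (R : realFieldType) (a b c d : R) : 0 <= formE a b c d.
Proof.
have -> : formE a b c d = (((a - b) * (c - d)) ^+ 2
    + ((a - c) * (b - d)) ^+ 2 + ((a - d) * (b - c)) ^+ 2) / 2.
  by rewrite /formE /e1 /e2 /e3 /e4; field.
by rewrite divr_ge0 ?ler0n // !addr_ge0 ?sqr_ge0.
Qed.

Lemma formC_ge0 (R : realFieldType) (a b c d : R) :
  0 <= a -> 0 <= b -> 0 <= c -> 0 <= d -> 0 <= formC a b c d.
Proof.
move=> a_ge0 b_ge0 c_ge0 d_ge0.
have -> : formC a b c d = (a - b) ^+ 2 * (c * d) + (a - c) ^+ 2 * (b * d)
    + (a - d) ^+ 2 * (b * c) + (b - c) ^+ 2 * (a * d)
    + (b - d) ^+ 2 * (a * c) + (c - d) ^+ 2 * (a * b).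
  by rewrite /formC /e1 /e3 /e4; ring.
by nonneg_terms.
Qed.

Lemma formB_ge0 (R : realFieldType) (a b c d : R) :
  0 <= a -> 0 <= b -> 0 <= c -> 0 <= d -> 0 <= formB a b c d.
Proof.
move=> a_ge0 b_ge0 c_ge0 d_ge0.
suff: 0 <= 0 * formA a b c d + 1 * formB a b c d + 0 * formC a b c d
           + 0 * formE a b c d by rewrite !(mul0r, mul1r, add0r, addr0).
move: a b c d a_ge0 b_ge0 c_ge0 d_ge0; apply: combination_sorted_ge0.
move=> d x y z d_ge0 x_ge0 y_ge0 z_ge0.
set Q := (X in 0 <= X).
have -> : Q =
    2 * x ^+ 2 * y ^+ 2 + 2 * x ^+ 2 * y * z + 2 * x ^+ 2 * z ^+ 2
      + 2 * x * y ^+ 3 + 3 * x * y ^+ 2 * z + 5 * x * y * z ^+ 2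
      + 2 * x * z ^+ 3 + y ^+ 2 * z ^+ 2 + y * z ^+ 3
    + d * (3 * x ^+ 3 + 6 * x ^+ 2 * y + 3 * x ^+ 2 * z + 10 * x * y ^+ 2
      + 10 * x * y * z + 7 * x * z ^+ 2 + 4 * y ^+ 3 + 6 * y ^+ 2 * z
      + 8 * y * z ^+ 2 + 3 * z ^+ 3)
    + d ^+ 2 * (3 * x ^+ 2 + 4 * x * y + 2 * x * z + 4 * y ^+ 2 + 4 * y * z
      + 3 * z ^+ 2).
  by rewrite /Q /formB /e1 /e2 /e3; ring.
by nonneg_terms.
Qed.

(** The zero [(w,1,1,1)] has its small variable equal to [w = 1 - t]: in terms
    of the gaps, [y = z = 0] and [x = t (d + x)].  The square must vanish
    there, which accounts for its leading term [3 x (x - D)]. *)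
Lemma pencil_le1 (R : realFieldType) (w a b c d : R) :
    0 <= w -> w <= 1 -> 0 <= a -> 0 <= b -> 0 <= c -> 0 <= d ->
  0 <= formA a b c d - 2 * w * formB a b c d + w ^+ 2 * formC a b c d.
Proof.
move=> w_ge0 w_le1 a_ge0 b_ge0 c_ge0 d_ge0.
suff: 0 <= 1 * formA a b c d + (- (2 * w)) * formB a b c d
           + w ^+ 2 * formC a b c d + 0 * formE a b c d.
  by rewrite mul1r mul0r addr0 mulNr.
move: a b c d a_ge0 b_ge0 c_ge0 d_ge0; apply: combination_sorted_ge0.
move=> d x y z d_ge0 x_ge0 y_ge0 z_ge0.
set Q := (X in 0 <= X); rewrite -(@pmulr_rge0 _ 3) //.
have [t [t_ge0 t_le1 wE]] : exists t, [/\ 0 <= t, t <= 1 & w = 1 - t].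
  by exists (1 - w); split; lra.
set D := t * (d + x).
have -> : 3 * Q = (3 * x * (x - D) + (2 * x - D - t * x) * (2 * y + z)) ^+ 2
    + (2 + 13 * t + t * (1 - t)) * x ^+ 2 * z ^+ 2
    + 8 * x ^+ 2 * y ^+ 2 + 8 * x ^+ 2 * y * z + 24 * x * y * z ^+ 2
      + 12 * x * z ^+ 3 + 24 * y ^+ 2 * z ^+ 2 + 24 * y * z ^+ 3 + 9 * z ^+ 4
    + t * (2 * x ^+ 2 * y ^+ 2 + 2 * x ^+ 2 * y * z + 24 * x * y * z ^+ 2
      + 12 * x * z ^+ 3 + 6 * y ^+ 2 * z ^+ 2 + 6 * y * z ^+ 3)
    + t * d * (16 * x * y ^+ 2 + 16 * x * y * z + 22 * x * z ^+ 2
      + 36 * y * z ^+ 2 + 18 * z ^+ 3)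
    + t ^+ 2 * (5 * x ^+ 2 * y ^+ 2 + 5 * x ^+ 2 * y * z + 6 * x * y ^+ 3
      + 9 * x * y ^+ 2 * z + 3 * x * y * z ^+ 2)
    + t ^+ 2 * d * (14 * x * y ^+ 2 + 14 * x * y * z + 8 * x * z ^+ 2
      + 12 * y ^+ 3 + 18 * y ^+ 2 * z + 6 * y * z ^+ 2)
    + t ^+ 2 * d ^+ 2 * (8 * y ^+ 2 + 8 * y * z + 8 * z ^+ 2).
  by rewrite /Q wE /D /formA /formB /formC /e1 /e2 /e3 /e4; ring.
by nonneg_terms.
Qed.

(** Now the zero [(w,1,1,1)] has its large variable equal to [w = 1 + v], that
    is [x = y = 0] and [z = v d]; the square vanishes there. *)
Lemma pencil_le5 (R : realFieldType) (w a b c d : R) :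
    1 <= w -> w <= 5 -> 0 <= a -> 0 <= b -> 0 <= c -> 0 <= d ->
  0 <= formA a b c d - 2 * w * formB a b c d + w ^+ 2 * formC a b c d.
Proof.
move=> w_ge1 w_le5 a_ge0 b_ge0 c_ge0 d_ge0.
suff: 0 <= 1 * formA a b c d + (- (2 * w)) * formB a b c d
           + w ^+ 2 * formC a b c d + 0 * formE a b c d.
  by rewrite mul1r mul0r addr0 mulNr.
move: a b c d a_ge0 b_ge0 c_ge0 d_ge0; apply: combination_sorted_ge0.
move=> d x y z d_ge0 x_ge0 y_ge0 z_ge0.
set Q := (X in 0 <= X); rewrite -(@pmulr_rge0 _ 3) //.
have [v [v_ge0 v_le4 wE]] : exists v, [/\ 0 <= v, v <= 4 & w = 1 + v].
  by exists (w - 1); split; lra.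
set D := v * (d + x).
have -> : 3 * Q = (3 * z * (z - D) + x * (2 * z - D + v * z)
                   + y * (4 * z - 2 * D - v * z)) ^+ 2
    + (2 + 4 * v + v * (4 - v)) * x ^+ 2 * z ^+ 2
    + (8 + 4 * v + v * (4 - v)) * x * y * z ^+ 2
    + (4 - v) * (2 + v) * y ^+ 2 * z ^+ 2
    + 9 * x ^+ 4 + 24 * x ^+ 3 * y + 12 * x ^+ 3 * z + 24 * x ^+ 2 * y ^+ 2
      + 24 * x ^+ 2 * y * z
    + v * (18 * x ^+ 4 + 48 * x ^+ 3 * y + 28 * x ^+ 3 * z
      + 30 * x ^+ 2 * y ^+ 2 + 46 * x ^+ 2 * y * z + 16 * x * y ^+ 2 * z)
    + v * d * (18 * x ^+ 3 + 36 * x ^+ 2 * y + 22 * x ^+ 2 * z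
      + 16 * x * y * z + 16 * y ^+ 2 * z)
    + v ^+ 2 * (8 * x ^+ 4 + 20 * x ^+ 3 * y + 8 * x ^+ 3 * z
      + 17 * x ^+ 2 * y ^+ 2 + 11 * x ^+ 2 * y * z + 6 * x * y ^+ 3
      + 5 * x * y ^+ 2 * z)
    + v ^+ 2 * d * (16 * x ^+ 3 + 28 * x ^+ 2 * y + 8 * x ^+ 2 * z
      + 22 * x * y ^+ 2 + 8 * x * y * z + 12 * y ^+ 3 + 14 * y ^+ 2 * z)
    + v ^+ 2 * d ^+ 2 * (8 * x ^+ 2 + 8 * x * y + 8 * y ^+ 2).
  by rewrite /Q wE /D /formA /formB /formC /e1 /e2 /e3 /e4; ring.
by nonneg_terms.
Qed.

(** Besides [(w,1,1,1)] the form vanishes at the points [(0,0,s,1)] with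
    [3 (s - 1)^2 = (w - 5) s]; in terms of the gaps these are [d = x = 0] and
    [3 z^2 = u y (y + z)] with [u = w - 5], hence the new term
    [- u y (y + z)] in the square. *)
Lemma pencil_ge5 (R : realFieldType) (w a b c d : R) :
    5 <= w -> 0 <= a -> 0 <= b -> 0 <= c -> 0 <= d ->
  0 <= 3 * (formA a b c d - 2 * w * formB a b c d + w ^+ 2 * formC a b c d)
       + (w - 5) ^+ 2 * formE a b c d.
Proof.
move=> w_ge5 a_ge0 b_ge0 c_ge0 d_ge0.
suff: 0 <= 3 * formA a b c d + (- (6 * w)) * formB a b c d
           + 3 * w ^+ 2 * formC a b c d + (w - 5) ^+ 2 * formE a b c d.
  by congr (0 <= _); ring.
move: a b c d a_ge0 b_ge0 c_ge0 d_ge0; apply: combination_sorted_ge0.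
move=> d x y z d_ge0 x_ge0 y_ge0 z_ge0.
set Q := (X in 0 <= X).
have [u [u_ge0 wE]] : exists u, 0 <= u /\ w = 5 + u.
  by exists (w - 5); split; lra.
set D := (4 + u) * (d + x).
have -> : Q = (3 * z * (z - D) + x * (6 * z - D + u * z) - 2 * D * y
               - u * y * (y + z)) ^+ 2
    + 209 * x ^+ 4 + 536 * x ^+ 3 * y + 252 * x ^+ 3 * z + 416 * x ^+ 2 * y ^+ 2
      + 384 * x ^+ 2 * y * z + 18 * x ^+ 2 * z ^+ 2 + 96 * x * y ^+ 3
      + 144 * x * y ^+ 2 * z + 24 * x * y * z ^+ 2
    + d * (328 * x ^+ 3 + 592 * x ^+ 2 * y + 216 * x ^+ 2 * z
      + 352 * x * y ^+ 2 + 192 * x * y * z + 192 * y ^+ 3 + 288 * y ^+ 2 * z)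
    + d ^+ 2 * (128 * x ^+ 2 + 128 * x * y + 128 * y ^+ 2)
    + u * (82 * x ^+ 4 + 208 * x ^+ 3 * y + 92 * x ^+ 3 * z
      + 158 * x ^+ 2 * y ^+ 2 + 134 * x ^+ 2 * y * z + 32 * x * y ^+ 3
      + 44 * x * y ^+ 2 * z)
    + u * d * (146 * x ^+ 3 + 260 * x ^+ 2 * y + 86 * x ^+ 2 * z
      + 168 * x * y ^+ 2 + 80 * x * y * z + 80 * y ^+ 3 + 104 * y ^+ 2 * z)
    + u * d ^+ 2 * (64 * x ^+ 2 + 64 * x * y + 64 * y ^+ 2)
    + u ^+ 2 * (8 * x ^+ 4 + 20 * x ^+ 3 * y + 8 * x ^+ 3 * z
      + 16 * x ^+ 2 * y ^+ 2 + 12 * x ^+ 2 * y * z + 4 * x * y ^+ 3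
      + 4 * x * y ^+ 2 * z)
    + u ^+ 2 * d * (16 * x ^+ 3 + 28 * x ^+ 2 * y + 8 * x ^+ 2 * z
      + 20 * x * y ^+ 2 + 8 * x * y * z + 8 * y ^+ 3 + 8 * y ^+ 2 * z)
    + u ^+ 2 * d ^+ 2 * (8 * x ^+ 2 + 8 * x * y + 8 * y ^+ 2).
  by rewrite /Q wE /D /formA /formB /formC /formE /e1 /e2 /e3 /e4; ring.
by nonneg_terms.
Qed.

Lemma formA_ge0 (R : realFieldType) (a b c d : R) :
  0 <= a -> 0 <= b -> 0 <= c -> 0 <= d -> 0 <= formA a b c d.
Proof.
move=> a_ge0 b_ge0 c_ge0 d_ge0.
have := @pencil_le1 R 0 a b c d (lexx 0) ler01 a_ge0 b_ge0 c_ge0 d_ge0.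
by rewrite mulr0 expr0n /= !mul0r subr0 addr0.
Qed.

(** The two quadratic hypotheses bound [C] and [E] below by their extremal
    values; as [formC] and [formE] are nonnegative, lowering [C] and [E] to
    these values only makes the claim stronger. *)
Lemma combination_orthant_ge0 (R : realFieldType) (A B C E a b c d : R) :
    0 <= A -> 0 <= E ->
    (forall t, 0 <= t -> 0 <= A * t ^+ 2 + B * t + C) ->
    (forall t, 0 <= t -> 0 <= 3 * A * t ^+ 2 + (10 * A + B) * t + 3 * E) ->
    0 <= a -> 0 <= b -> 0 <= c -> 0 <= d ->
  0 <= A * formA a b c d + B * formB a b c d + C * formC a b c d
       + 3 * E * formE a b c d.
Proof.
move=> A_ge0 E_ge0 q_ge0 r_ge0 a_ge0 b_ge0 c_ge0 d_ge0.
have FA := formA_ge0 a_ge0 b_ge0 c_ge0 d_ge0.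
have FB := formB_ge0 a_ge0 b_ge0 c_ge0 d_ge0.
have FC := formC_ge0 a_ge0 b_ge0 c_ge0 d_ge0.
have FE := formE_ge0 a b c d.
have C_ge0 : 0 <= C by have := q_ge0 0 (lexx 0); lra.
have [B_ge0|B_lt0] := leP 0 B; first by nonneg_terms.
have [A_gt0 disc] := quadratic_halfline A_ge0 q_ge0 B_lt0.
have [w [w_ge0 BE]] : exists w, 0 <= w /\ B = - (2 * A * w).
  exists (- B / (2 * A)); split; last by field; rewrite gt_eqF.
  by apply: divr_ge0; lra.
have CE : 0 <= C - A * w ^+ 2.
  rewrite -(@pmulr_rge0 _ (4 * A)) ?mulr_gt0 //; move: disc; rewrite BE; nra.
have [w_le5|w_gt5] := leP w 5.
  have pencil : 0 <= formA a b c d - 2 * w * formB a b c d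
                     + w ^+ 2 * formC a b c d.
    have [w_le1|/ltW w_ge1] := leP w 1; first exact: pencil_le1.
    exact: pencil_le5.
  have -> : A * formA a b c d + B * formB a b c d + C * formC a b c d
      + 3 * E * formE a b c d
    = A * (formA a b c d - 2 * w * formB a b c d + w ^+ 2 * formC a b c d)
      + (C - A * w ^+ 2) * formC a b c d + 3 * E * formE a b c d.
    by rewrite BE; ring.
  by rewrite !addr_ge0 ?mulr_ge0.
have := @pencil_ge5 R w a b c d (ltW w_gt5) a_ge0 b_ge0 c_ge0 d_ge0.
set T := (X in 0 <= X -> _) => T_ge0.
have r_lt0 : 10 * A + B < 0 by rewrite BE; nra.
have [_ disc5] := quadratic_halfline (mulr_ge0 (ler0n _ 3) A_ge0) r_ge0 r_lt0.
have EE : 0 <= 9 * E - A * (w - 5) ^+ 2.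
  rewrite -(@pmulr_rge0 _ (4 * A)) ?mulr_gt0 //; move: disc5; rewrite BE; nra.
have -> : A * formA a b c d + B * formB a b c d + C * formC a b c d
    + 3 * E * formE a b c d
  = (A * T + (9 * E - A * (w - 5) ^+ 2) * formE a b c d) / 3
    + (C - A * w ^+ 2) * formC a b c d.
  by rewrite BE /T; field.
by rewrite addr_ge0 ?divr_ge0 ?addr_ge0 ?mulr_ge0.
Qed.

(** On [t > 0] the value [f(0,0,t,1) / t^2] only depends on [(t - 1)^2 / t],
    which takes every nonnegative value. *)
Lemma inversion_parameter (R : rcfType) (z : R) :
  0 <= z -> exists2 t : R, 0 < t & (t - 1) ^+ 2 = z * t.
Proof.
move=> z_ge0; have D_ge0 : 0 <= z ^+ 2 + 4 * z by nonneg_terms.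
have s_ge0 := sqrtr_ge0 (z ^+ 2 + 4 * z); have := sqr_sqrtr D_ge0.
move: (Num.sqrt _) s_ge0 => s s_ge0 sE.
exists ((2 + z + s) / 2); first by rewrite divr_gt0 //; lra.
have -> : ((2 + z + s) / 2 - 1) ^+ 2 = (z ^+ 2 + 2 * z * s + s ^+ 2) / 4.
  by field.
by rewrite sE; field.
Qed.

Theorem theorem1p9 (R : realType) (f : {mpoly R[4]})
    (f_sym : f \is symmetric) (f_form : f \is 4.-homog)
    (f_one : eval4 R f 1 1 1 1 = 0) :
  (0 <= eval4 R f (-1) (-1) 1 1 ->
   (forall t : R, 0 <= eval4 R f t 1 1 1) ->
   forall a b c d : R, 0 <= eval4 R f a b c d)
  /\
  ((forall t : R, 0 <= t -> 0 <= eval4 R f t 1 1 1 /\ 0 <= eval4 R f 0 0 t 1) ->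
   forall a b c d : R, 0 <= a -> 0 <= b -> 0 <= c -> 0 <= d ->
     0 <= eval4 R f a b c d).
Proof.
have [A [B [C [E fE]]]] := symmetric_quartic4_vanishing f_sym f_form f_one.
have {}fE a b c d : 0 <= A * formA a b c d + B * formB a b c d
    + C * formC a b c d + 3 * E * formE a b c d <-> 0 <= eval4 R f a b c d.
  by rewrite -fE pmulr_rge0.
have t111 t : 0 <= eval4 R f t 1 1 1 ->
    0 <= (t - 1) ^+ 2 * (A * t ^+ 2 + B * t + C).
  by move=> /fE; rewrite combination_t111 pmulr_rge0.
have q_ge0 t : 0 <= A + B + C -> 0 <= eval4 R f t 1 1 1 ->
    0 <= A * t ^+ 2 + B * t + C.
  move=> q1 /t111; have [->|t1] := eqVneq t 1.
    by rewrite expr1n !mulr1.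
  by rewrite pmulr_rge0 // exprn_even_gt0 //= subr_eq0.
split=> [f_m1 f_t a b c d|f_t a b c d a_ge0 b_ge0 c_ge0 d_ge0]; apply/fE.
- have q1 := quadratic_ge0_at1 (fun t _ => t111 t (f_t t)).
  have {}q_ge0 t : 0 <= A * t ^+ 2 + B * t + C by apply: q_ge0.
  apply: combination_ge0 => //.
  move/fE: f_m1; set Q := (X in 0 <= X -> _).
  have -> : Q = 16 * (3 * E - (A + B + C)).
    by rewrite /Q /formA /formB /formC /formE /e1 /e2 /e3 /e4; ring.
  by rewrite pmulr_rge0.
- have f_00t1 t : 0 <= t -> 0 <= (t - 1) ^+ 2
      * (3 * A * (t - 1) ^+ 2 + (10 * A + B) * t) + 3 * E * t ^+ 2.
    by move=> /f_t[_ /fE]; rewrite combination_00t1.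
  have q1 := quadratic_ge0_at1 (fun t t_ge0 => t111 t (f_t t t_ge0).1).
  apply: combination_orthant_ge0 => //.
  + by have := f_00t1 0 (lexx 0); nra.
  + by have := f_00t1 1 ler01; nra.
  + by move=> t t_ge0; apply: q_ge0 => //; case: (f_t t t_ge0).
  + move=> z /inversion_parameter[t t_gt0 tE].
    have := f_00t1 t (ltW t_gt0); rewrite tE.
    have -> : z * t * (3 * A * (z * t) + (10 * A + B) * t) + 3 * E * t ^+ 2
      = t ^+ 2 * (3 * A * z ^+ 2 + (10 * A + B) * z + 3 * E) by ring.
    by rewrite pmulr_rge0 // exprn_gt0.
Qed.
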